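(* Let $\phi=(\phi_{i,j})_{i,j\ge1}$ be a non-negative symmetric kernel with $\phi_{i,j}\le ij$ for all $i,j\in\mathbb{N}$, and suppose in addition that $\phi$ satisfies one of the following three conditions: (1) $\phi_{i,j}\le \frac{i+j}{\min\{i,j\}}$ for all $i,j\in\mathbb{N}$; (2) $\phi_{i,j}\le i+j$ for all $i,j\in\mathbb{N}$; (3) $\phi_{i,j}\le (1+i+j)^{\alpha}$ for all $i,j\in\mathbb{N}$, for some $\alpha\in[0,1]$. Let $c^0\in B^+$ and let $c=(c_i)$, with values in $B^+$, be a solution on $[0,\infty)$ of the Safronov-Dubovski initial value problem with initial datum $c^0$. If, additionally, $\phi_{n,j}\to0$ as $n\to\infty$ for every $j\in\mathbb{N}$, then the solution is density conserving: for all $t\ge0$, $$\sum_{i=1}^\infty i\,c_i(t)=\sum_{i=1}^\infty i\,c_i(0).$$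
   Context: Here $\mathbb{N}=\{1,2,\dots\}$. The Safronov-Dubovski initial value problem is $$\frac{dc_i(t)}{dt}=c_{i-1}(t)\sum_{j=1}^{i-1}j\phi_{i-1,j}c_j(t)-c_i(t)\sum_{j=1}^{i}j\phi_{i,j}c_j(t)-\sum_{j=i}^{\infty}\phi_{i,j}c_i(t)c_j(t),\quad i\ge1,\ t\ge 0,$$ with $c_i(0)=c_i^0\ge0$, where the first term is absent for $i=1$. The kernel satisfies $\phi_{i,j}\ge0$ and $\phi_{i,j}=\phi_{j,i}$. Spaces: $B=\{z=(z_d)_{d\ge1}:\|z\|<\infty\}$ with $\|z\|=\sum_{d=1}^\infty d|z_d|$, and $B^+=\{c=(c_i)\in B: c_i\ge0 \text{ for all } i\}$. Definition of solution: let $T\in(0,\infty]$. A solution of the initial value problem on $[0,T)$ is a function $c=(c_i):[0,T)\to B^+$ such that: 1. every $c_i$ is continuous and $\sup_{0\le t<T}\|c(t)\|<\infty$; 2. $\int_0^t\sum_{j=1}^\infty\phi_{i,j}c_j(h)\,dh<\infty$ for every $i$ and every $0\le t<T$; 3. for every $i$ and every $0\le t<T$, $$c_i(t)=c_i(0)+\int_0^t\Bigl(\delta_{i\ge2}\,c_{i-1}(h)\sum_{j=1}^{i-1}j\phi_{i-1,j}c_j(h)-c_i(h)\sum_{j=1}^{i}j\phi_{i,j}c_j(h)-c_i(h)\sum_{j=i}^\infty\phi_{i,j}c_j(h)\Bigr)dh,$$ with $c_i(0)=c_i^0$, where $\delta_P=1$ if $P$ is true and $0$ otherwise. *)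

(* Defs.v *)
From HB Require Import structures.
From mathcomp Require Import all_boot all_order all_algebra.
From mathcomp Require Import all_classical all_reals all_analysis.
Import Order.TTheory GRing.Theory Num.Theory.
Import numFieldNormedType.Exports.

Set Implicit Arguments.
Unset Strict Implicit.
Unset Printing Implicit Defensive.

Local Open Scope classical_set_scope.
Local Open Scope ring_scope.

(* Sequences (z_d)_{d >= 1} and kernels (phi_{i,j})_{i,j >= 1} are functions on
   nat whose values at index 0 are never used: sums start at 1 and pointwise
   conditions are restricted to positive indices. *)

Definition sdnorm (R : realType) (z : nat -> R) : \bar R :=
  (\sum_(1 <= d <oo) (d%:R * `|z d|)%:E)%E.

Definition spaceB (R : realType) : set (nat -> R) :=
  [set z | (sdnorm z < +oo)%E].

Definition spaceBpos (R : realType) : set (nat -> R) :=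
  [set z | spaceB z /\ forall i, (0 < i)%N -> 0 <= z i].

Definition nonneg_symmetric_kernel (R : realType) (phi : nat -> nat -> R) : Prop :=
  forall i j, (0 < i)%N -> (0 < j)%N -> 0 <= phi i j /\ phi i j = phi j i.

(* The last series is summed in \bar R.  It may be +oo, but the two other terms
   are finite, so no indeterminate +oo - oo occurs. *)
Definition sd_rhs (R : realType) (phi : nat -> nat -> R) (z : nat -> R)
    (i : nat) : \bar R :=
  (((2 <= i)%N%:R * (z i.-1 * \sum_(1 <= j < i) j%:R * phi i.-1 j * z j))%:E
   - (z i * \sum_(1 <= j < i.+1) j%:R * phi i j * z j)%:E
   - (z i)%:E * \sum_(i <= j <oo) (phi i j * z j)%:E)%E.

Definition time_interval (R : realType) (T : \bar R) : set R :=
  [set t | 0 <= t /\ (t%:E < T)%E].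

(* [c t i] is c_i(t); the values of [c] outside [0, T) are irrelevant. *)
Record sd_solution (R : realType) (phi : nat -> nat -> R) (c0 : nat -> R)
    (T : \bar R) (c : R -> nat -> R) : Prop := SDSolution {
  sd_horizon : (0 < T)%E ;
  sd_values : forall t, time_interval T t -> spaceBpos (c t) ;
  sd_continuous : forall i, (0 < i)%N ->
    {within time_interval T, continuous (fun t => c t i)} ;
  sd_bounded :
    (ereal_sup [set sdnorm (c t) | t in time_interval T] < +oo)%E ;
  sd_integrable : forall i t, (0 < i)%N -> time_interval T t ->
    (\int[lebesgue_measure]_(h in `[0%R, t])
       (\sum_(1 <= j <oo) (phi i j * c h j)%:E) < +oo)%E ;
  sd_initial : forall i, (0 < i)%N -> c 0 i = c0 i ;
  sd_integral_equation : forall i t, (0 < i)%N -> time_interval T t ->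
    ((c t i)%:E =
     (c 0%R i)%:E + \int[lebesgue_measure]_(h in `[0%R, t]) sd_rhs phi (c h) i)%E
}.

Definition density (R : realType) (z : nat -> R) : \bar R :=
  (\sum_(1 <= i <oo) (i%:R * z i)%:E)%E.

(* Main.v *)
(* Each of the three conditions gives phi i j <= 2 (i + j).  Let M_n be the sum
   of the i c_i for i <= n.  The flux telescopes and leaves
     - M_n' = (n+1) c_n sum_(j<=n) j phi_(n,j) c_j
              + sum_(i<=n) i c_i sum_(j>n) phi_(i,j) c_j,
   so linear growth of phi and a bound M on the norm give
     0 <= - M_n' <= 4 M ((n+1) n c_n + sum_(j>n) j c_j).
   Put a_n = int_0^t n c_n.  The a_n are summable, so the tails vanish, and
   (n+1) a_n is arbitrarily small for arbitrarily large n, since otherwise a_n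
   would dominate a multiple of the harmonic series.  Hence M_n(0) - M_n(t),
   which is nonnegative, is arbitrarily small for arbitrarily large n. *)
Require Import Defs.
From HB Require Import structures.
From mathcomp Require Import all_boot all_order all_algebra.
From mathcomp Require Import all_classical all_reals all_analysis.
From mathcomp Require Import measurable_realfun ring lra.
Import Order.TTheory GRing.Theory Num.Theory.
Import numFieldNormedType.Exports.

Local Open Scope classical_set_scope.
Local Open Scope ring_scope.

(* T i stands for the tail of the loss series beyond n; leaving it arbitrary
   lets the induction on n absorb the term j = n+1 into it. *)
Lemma truncated_moment_flux (R : comNzRingType) (phi : nat -> nat -> R)
    (z T : nat -> R) (n : nat) :
  (forall i j, (0 < i)%N -> (0 < j)%N -> phi i j = phi j i) ->
  \sum_(1 <= i < n.+1) i%:R *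
    ((2 <= i)%N%:R * (z i.-1 * \sum_(1 <= j < i) j%:R * phi i.-1 j * z j)
     - z i * (\sum_(1 <= j < i.+1) j%:R * phi i j * z j)
     - z i * (\sum_(i <= j < n.+1) phi i j * z j + T i))
  = - (n.+1%:R * (z n * \sum_(1 <= j < n.+1) j%:R * phi n j * z j)
       + \sum_(1 <= i < n.+1) i%:R * z i * T i).
Proof.
move=> phiC; elim: n T => [|n IH] T; first by rewrite !big_geq// !mulr0 addr0 oppr0.
rewrite big_nat_recr//=.
under eq_big_nat => i /andP[_ iltn].
  rewrite [\sum_(i <= j < n.+2) _]big_nat_recr/= ?(ltnW iltn)// -[_ + T i]addrA.
  over.
have /= -> := IH (fun i => phi i n.+1 * z n.+1 + T i).
rewrite big_nat1 [\sum_(1 <= j < n.+2) _ * phi _ _ * _]big_nat_recr//=.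
rewrite [\sum_(1 <= i < n.+2) _ * T _]big_nat_recr//=.
set A := \sum_(1 <= j < n.+1) j%:R * phi n j * z j.
set B := \sum_(1 <= j < n.+1) j%:R * phi n.+1 j * z j.
(* By symmetry of [phi] the absorbed terms form one more copy of [B * z n.+1]. Together with the
   loss of index n+1, which carries the factor n+1, it produces the factor n+2 of the next flux. *)
have -> : \sum_(1 <= i < n.+1) i%:R * z i * (phi i n.+1 * z n.+1 + T i) =
  B * z n.+1 + \sum_(1 <= i < n.+1) i%:R * z i * T i.
  rewrite mulr_suml -big_split/=; apply: eq_big_nat => i /andP[i0 _].
  by rewrite (phiC i)//; ring.
have -> : ((1 < n.+1)%N%:R * (z n * A) : R) = z n * A.
  by rewrite /A; case: n {IH A B} => [|n]; rewrite ?mul1r// big_geq// !mulr0.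
by rewrite -[n.+2%:R]natr1; ring.
Qed.

(** Otherwise [a n] exceeds e/(n+1) for all n >= N, and comparison makes the harmonic series
    converge. *)
Lemma summable_frequently_le_harmonic (R : realType) (a : nat -> R) (A e : R) N :
  (forall n, 0 <= a n) -> (forall n, \sum_(0 <= i < n) a i <= A) -> 0 < e ->
  exists2 n, (N <= n)%N & n.+1%:R * a n <= e.
Proof.
move=> a0 aA e0; apply: contrapT => H.
have {}H n : (N <= n)%N -> e < n.+1%:R * a n.
  by move=> Nn; rewrite ltNge; apply/negP => ?; apply: H; exists n.
apply: (@dvg_harmonic R).
(* The indicator dominates the harmonic terms, all at most 1, at the indices below N, where [a] has
   no lower bound but 0. It adds at most N to the partial sums. *)
apply: (@series_le_cvg _ _ (fun n => e^-1 * a n + (n < N)%N%:R)).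
- by move=> n; rewrite invr_ge0.
- by move=> n; rewrite addr_ge0// mulr_ge0// invr_ge0 ltW.
- move=> n; case: ltnP => [_|/H Hn] /=.
    rewrite (@le_trans _ _ 1)//; first by rewrite invf_le1// ler1n.
    by rewrite lerDr mulr_ge0// invr_ge0 ltW.
  by rewrite addr0 mulrC ler_pdivlMr// ler_pdivrMl// ltW.
- apply: nondecreasing_is_cvgn.
    apply/nondecreasing_seqP => n; rewrite /series/= big_nat_recr//= lerDl.
    by rewrite addr_ge0// mulr_ge0// invr_ge0 ltW.
  exists (e^-1 * A + N%:R) => _ [n _ <-]; rewrite /series/= big_split/=.
  rewrite -mulr_sumr lerD//; first by rewrite ler_wpM2l// invr_ge0 ltW.
  rewrite -natr_sum ler_nat -big_mkcond/= sum1_count -size_filter.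
  rewrite -[leqRHS](size_iota 0) uniq_leq_size ?filter_uniq ?iota_uniq//.
  by move=> k; rewrite mem_filter mem_iota add0n; case/andP.
Qed.

(* +oo - +oo = -oo in \bar R, so a finite integral has finite positive and
   negative parts. *)
Lemma fin_num_integral_integrable d (T : measurableType d) (R : realType)
    (mu : {measure set T -> \bar R}) (D : set T) (f : T -> \bar R) :
  measurable D -> measurable_fun D f ->
  (\int[mu]_(x in D) f x)%E \is a fin_num -> mu.-integrable D f.
Proof.
move=> mD mf; rewrite integralE fin_numB => /andP[fp fn].
apply/integrableP; split=> //.
under eq_integral do rewrite -/((abse \o f) _) fune_abse.
rewrite ge0_integralD//.
- by rewrite lte_add_pinfty// ltey_eq ?fp ?fn.
- exact: measurable_funepos.
- exact: measurable_funeneg.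
Qed.

Lemma le_nneseries_from (R : realType) (u v : nat -> \bar R) N :
  (forall i, (N <= i)%N -> 0 <= u i)%E ->
  (forall i, (N <= i)%N -> u i <= v i)%E ->
  (\sum_(N <= i <oo) u i <= \sum_(N <= i <oo) v i)%E.
Proof.
move=> u0 uv; rewrite eseries_cond [leRHS]eseries_cond.
by apply: lee_nneseries => [i _|i] /andP[_ ?]; [exact: u0|exact: uv].
Qed.

(** * Kernel growth and bounds on the truncated flux at a fixed time *)

(** In the first case the minimum is at least 1. In the third the base is at least 1, so the
    exponent may be raised to 1, and 1 <= i + j costs the factor 2. *)
Lemma kernel_linear_growth (R : realType) (phi : nat -> nat -> R) :
  [\/ (forall i j, (0 < i)%N -> (0 < j)%N ->
         phi i j <= (i%:R + j%:R) / (minn i j)%:R),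
      (forall i j, (0 < i)%N -> (0 < j)%N -> phi i j <= i%:R + j%:R)
    | (exists alpha : R, 0 <= alpha <= 1 /\
         forall i j, (0 < i)%N -> (0 < j)%N ->
           phi i j <= (1 + i%:R + j%:R) `^ alpha)] ->
  forall i j, (0 < i)%N -> (0 < j)%N -> phi i j <= 2 * (i%:R + j%:R).
Proof.
move=> H i j i0 j0.
have i1 : 1 <= i%:R :> R by rewrite ler1n.
have j1 : 1 <= j%:R :> R by rewrite ler1n.
case: H => [H|H|[al [/andP[al0 al1] H]]]; apply: (le_trans (H i j i0 j0)).
- rewrite ler_pdivrMr ?ltr0n ?leq_min ?i0//.
  have m1 : 1 <= (minn i j)%:R :> R by rewrite ler1n leq_min i0.
  nra.
- lra.
- apply: (@le_trans _ _ ((1 + i%:R + j%:R) `^ 1)).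
    by apply: ler_powR => //; lra.
  by rewrite powRr1; lra.
Qed.

(** The flux identity gives -s = (n+1) J + Q with J and Q nonnegative. The constant 4 comes from
    2(i+j) <= 4 max(i,j), the maximum being n in J and the tail index j in Q. *)
Lemma truncated_moment_rhs_bounds (R : realType) (phi : nat -> nat -> R)
    (z : nat -> R) (M : R) (n : nat) :
  nonneg_symmetric_kernel phi ->
  (forall i j, (0 < i)%N -> (0 < j)%N -> phi i j <= 2 * (i%:R + j%:R)) ->
  (forall i, (0 < i)%N -> 0 <= z i) ->
  (\sum_(0 <= j <oo) (j%:R * z j)%:E <= M%:E)%E ->
  let s := (\sum_(1 <= i < n.+1) i%:R%:E * sd_rhs phi z i)%E in
  [/\ (s <= 0)%E &
      (- s <= (4 * M)%:E * ((n.+1%:R)%:E * (n%:R * z n)%:E +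
               \sum_(n.+1 <= j <oo) (j%:R * z j)%:E))%E].
Proof.
move=> hphi hgr z0 zM s.
have phi0 i j : (0 < i)%N -> (0 < j)%N -> 0 <= phi i j.
  by move=> i0 j0; case: (hphi i j i0 j0).
have w0 j : (0 <= (j%:R * z j)%:E)%E.
  by case: j => [|j]; rewrite ?mul0r// lee_fin mulr_ge0// z0.
have M0 : 0 <= M by rewrite -lee_fin (le_trans _ zM)// nneseries_ge0.
have sM : \sum_(1 <= j < n.+1) j%:R * z j <= M.
  rewrite -lee_fin -sumEFin (le_trans _ zM)//.
  apply: le_trans (nneseries_lim_ge n.+1 _) => //.
  by rewrite [leRHS]big_ltn// leeDr.
have splitw : (\sum_(0 <= j <oo) (j%:R * z j)%:E =
    \sum_(0 <= j < n.+1) (j%:R * z j)%:E +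
    \sum_(n.+1 <= j <oo) (j%:R * z j)%:E)%E.
  exact: (nneseries_split 0 n.+1).
set tail := (\sum_(n.+1 <= j <oo) (j%:R * z j)%:E)%E in splitw *.
have tail0 : (0 <= tail)%E by apply: nneseries_ge0.
have tailM : (tail <= M%:E)%E.
  by apply: le_trans zM; rewrite splitw leeDr// sume_ge0.
have tailfin : tail \is a fin_num.
  by rewrite ge0_fin_numE// (le_lt_trans tailM)// ltry.
have phiz0 i j : (0 < i)%N -> (0 < j)%N -> 0 <= phi i j * z j.
  by move=> i0 j0; rewrite mulr_ge0 ?phi0// z0.
have phiz_le i j : (0 < i)%N -> (i <= j)%N -> phi i j * z j <= 4 * (j%:R * z j).
  move=> i0 ij; have j0 := leq_trans i0 ij.
  rewrite mulrA ler_wpM2r ?z0//; apply: (le_trans (hgr i j i0 j0)).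
  have : i%:R <= j%:R :> R by rewrite ler_nat.
  lra.
(* The flux identity needs real tails. [TE] shows that [fine] loses nothing for 0 < i <= n+1, the
   tail being at most 4 times that of the first moment. *)
pose T i := fine (\sum_(n.+1 <= j <oo) (phi i j * z j)%:E)%E.
have tail_phi0 i : (0 < i)%N -> (0 <= \sum_(n.+1 <= j <oo) (phi i j * z j)%:E)%E.
  move=> i0; apply: nneseries_ge0 => j nj _.
  by rewrite lee_fin phiz0// (leq_trans _ nj).
have tail_phi_le i : (0 < i)%N -> (i <= n.+1)%N ->
    (\sum_(n.+1 <= j <oo) (phi i j * z j)%:E <= 4%:E * tail)%E.
  move=> i0 iltn; rewrite -nneseriesZl//; apply: le_nneseries_from => j nj.
    by rewrite lee_fin phiz0// (leq_trans _ nj).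
  by rewrite -EFinM lee_fin phiz_le// (leq_trans _ nj).
have TE i : (0 < i)%N -> (i <= n.+1)%N ->
    (T i)%:E = (\sum_(n.+1 <= j <oo) (phi i j * z j)%:E)%E.
  move=> i0 iltn; rewrite fineK// ge0_fin_numE ?tail_phi0//.
  rewrite (le_lt_trans (tail_phi_le i i0 iltn))//.
  by rewrite -(fineK tailfin) -EFinM ltry.
pose J := z n * \sum_(1 <= j < n.+1) j%:R * phi n j * z j.
pose Q := \sum_(1 <= i < n.+1) i%:R * z i * T i.
have sE : s = (- (n.+1%:R * J + Q))%:E.
  rewrite /s /J /Q -truncated_moment_flux; last first.
    by move=> i j i0 j0; case: (hphi i j i0 j0).
  rewrite -sumEFin; apply: eq_big_nat => i /andP[i0 ilen].
  rewrite /sd_rhs.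
  have -> : (\sum_(i <= j <oo) (phi i j * z j)%:E =
      (\sum_(i <= j < n.+1) phi i j * z j + T i)%:E)%E.
    rewrite (nneseries_split i (n.+1 - i)); last first.
      by move=> k ik; rewrite lee_fin phiz0// (leq_trans i0).
    by rewrite subnKC ?(ltnW ilen)// EFinD -sumEFin TE// ltnW.
  by rewrite !(EFinM, EFinB).
(* The case n = 0 is separate because [z 0] and [phi 0 j] are unconstrained; there [J] is an empty
   sum. *)
have n_or : n = 0%N \/ (0 < n)%N by case: (n); [left|right].
have J0 : 0 <= J.
  rewrite /J; case: n_or => [->|n0]; first by rewrite big_geq// mulr0.
  rewrite mulr_ge0 ?z0// big_nat_cond; apply: sumr_ge0 => j /andP[/andP[j0 _] _].
  by rewrite mulr_ge0 ?z0// mulr_ge0// phi0.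
have JM : J <= 4 * M * (n%:R * z n).
  rewrite /J; case: n_or => [->|n0]; first by rewrite big_geq// mul0r !mulr0.
  have -> : 4 * M * (n%:R * z n) = z n * (4 * n%:R * M) by ring.
  rewrite ler_wpM2l ?z0// (@le_trans _ _ (4 * n%:R * \sum_(1 <= j < n.+1) j%:R * z j))//.
    rewrite mulr_sumr; apply: ler_sum_nat => j /andP[j0 jn].
    rewrite mulrA ler_wpM2r ?z0// mulrC ler_wpM2r//.
    apply: (le_trans (hgr n j n0 j0)).
    have : j%:R <= n%:R :> R by rewrite ler_nat.
    lra.
  by rewrite ler_wpM2l// mulr_ge0.
have T0 i : 0 <= i%:R * z i * T i.
  case: i => [|i]; first by rewrite !mul0r.
  by rewrite mulr_ge0 ?mulr_ge0 ?z0// fine_ge0// tail_phi0.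
have Q0 : 0 <= Q by apply: sumr_ge0.
have QM : Q <= 4 * M * fine tail.
  apply: (@le_trans _ _ ((\sum_(1 <= i < n.+1) i%:R * z i) * (4 * fine tail))).
    rewrite mulr_suml; apply: ler_sum_nat => i /andP[i0 ilen].
    rewrite ler_wpM2l ?mulr_ge0 ?z0// -lee_fin EFinM (fineK tailfin) TE ?tail_phi_le//;
      exact: ltnW.
  by rewrite [4 * M]mulrC -mulrA ler_wpM2r// mulr_ge0// fine_ge0.
rewrite sE lee_fin oppr_le0; split; first by rewrite addr_ge0// mulr_ge0.
rewrite -(fineK tailfin) -EFinN -!EFinM lee_fin opprK mulrDr lerD//.
by rewrite [leRHS]mulrCA ler_wpM2l.
Qed.

Theorem theorem2 (R : realType) (phi : nat -> nat -> R)
  (hphi : nonneg_symmetric_kernel phi)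
  (hprod : forall i j, (0 < i)%N -> (0 < j)%N -> phi i j <= i%:R * j%:R)
  (hcond :
    [\/ (forall i j, (0 < i)%N -> (0 < j)%N ->
           phi i j <= (i%:R + j%:R) / (minn i j)%:R),
        (forall i j, (0 < i)%N -> (0 < j)%N -> phi i j <= i%:R + j%:R)
      | (exists alpha : R, 0 <= alpha <= 1 /\
           forall i j, (0 < i)%N -> (0 < j)%N ->
             phi i j <= (1 + i%:R + j%:R) `^ alpha)])
  (c0 : nat -> R) (hc0 : spaceBpos c0)
  (c : R -> nat -> R) (hc : sd_solution phi c0 +oo%E c)
  (hlim : forall j, (0 < j)%N -> phi n j @[n --> \oo] --> (0 : R)) :
  forall t : R, 0 <= t -> density (c t) = density (c 0).
Proof.

(* Uniform moment bound, measurability and integrability *)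
have hgr := kernel_linear_growth _ _ hcond.
have inT (h : R) : 0 <= h -> time_interval +oo%E h by move=> h0; split=> //; rewrite ltry.
have cge0 (h : R) i : 0 <= h -> (0 < i)%N -> 0 <= c h i.
  by move=> h0 i0; have [_] := sd_values hc (inT h h0); exact.
have w0 (h : R) j : 0 <= h -> (0 <= (j%:R * c h j)%:E)%E.
  by move=> h0; case: j => [|j]; rewrite ?mul0r// lee_fin mulr_ge0// cge0.
(* Starting the series at 0 is harmless, since the weight vanishes there, and makes every term
   nonnegative without a side condition on the index. *)
have [M cM] : exists M : R, forall h : R, 0 <= h ->
    (\sum_(0 <= j <oo) (j%:R * c h j)%:E <= M%:E)%E.
  have := sd_bounded hc; set B := ereal_sup _ => Boo.
  have leB (h : R) : 0 <= h -> (sdnorm (c h) <= B)%E.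
    by move=> h0; apply: ereal_sup_ubound; exists h => //; exact: inT.
  have B0 : (0 <= B)%E.
    by rewrite (le_trans _ (leB 0 _))// nneseries_ge0.
  exists (fine B) => h h0; rewrite fineK ?ge0_fin_numE// (le_trans _ (leB h h0))//.
  rewrite (nneseries_split 0 1)//; last by move=> j _; exact: w0.
  rewrite big_nat1 mul0r add0e; apply: le_nneseries_from => j j0.
    exact: w0.
  by rewrite ger0_norm// cge0.
move=> t t0.
pose D : set R := `[0, t]%classic.
have mD : measurable D by exact: measurable_itv.
have D0 (h : R) : D h -> 0 <= h by rewrite /D/= in_itv/= => /andP[].
have mc i : (0 < i)%N -> measurable_fun D (c ^~ i).
  move=> i0; apply: subspace_continuous_measurable_fun => //.
  apply: continuous_subspaceW (sd_continuous hc i0) => h /D0; exact: inT.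
have mw j : measurable_fun D (fun h => (j%:R * c h j)%:E).
  apply/measurable_EFinP; case: j => [|j].
    under eq_fun do rewrite mul0r.
    exact: measurable_cst.
  by apply: measurable_funM => //; exact: mc.
have mseries i k : (0 < i)%N -> (0 < k)%N ->
    measurable_fun D (fun h => \sum_(k <= j <oo) (phi i j * c h j)%:E)%E.
  move=> i0 k0; under eq_fun do rewrite eseries_cond.
  apply: (@ge0_emeasurable_sum _ _ _ _ _ (leq k)) => [j h /D0 h0|j] /(leq_trans k0) j0.
    by rewrite lee_fin mulr_ge0 ?cge0//; case: (hphi i j i0 j0).
  by apply/measurable_EFinP; apply: measurable_funM => //; exact: mc.
have msum i n : measurable_fun D
    (fun h => \sum_(1 <= j < n) j%:R * phi i j * c h j).
  under eq_fun do rewrite big_nat_cond big_mkcond/=.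
  apply: measurable_sum => j; case: (boolP ((0 < j < n)%N && true)) => // /andP[/andP[j0 _] _].
  by apply: measurable_funM => //; exact: mc.
have mrhs i : (0 < i)%N -> measurable_fun D (fun h => sd_rhs phi (c h) i).
  move=> i0; apply: emeasurable_funB.
    apply: emeasurable_funB; apply/measurable_EFinP.
      case: i i0 => [//|[|i]] _ /=.
        under eq_fun do rewrite mul0r.
        exact: measurable_cst.
      by apply: measurable_funM => //; apply: measurable_funM => //; exact: mc.
    by apply: measurable_funM => //; exact: mc.
  by apply: emeasurable_funM; [apply/measurable_EFinP; exact: mc|exact: mseries].
have irhs i : (0 < i)%N -> (@lebesgue_measure R).-integrable D (fun h => sd_rhs phi (c h) i).
  move=> i0; apply: fin_num_integral_integrable => //; first exact: mrhs.
  (* Both c_i(t) and c_i(0) are real, so the equation excludes an infinite integral. *)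
  have := sd_integral_equation hc i0 (inT t t0).
  rewrite -/D; by case: (\int[lebesgue_measure]_(h in D) _)%E.
pose f i (h : R) := (i%:R%:E * sd_rhs phi (c h) i)%E.
have intf i : (@lebesgue_measure R).-integrable D (f i).
  case: (posnP i) => [->|i0]; last by apply: integrableZl => //; exact: irhs.
  rewrite /f; under eq_fun do rewrite mul0e.
  exact: integrable0.
pose s n (h : R) := (\sum_(1 <= i < n.+1) f i h)%E.
have ints n : (@lebesgue_measure R).-integrable D (s n) by exact: integrable_sum.
have ms n : measurable_fun D (fun h => - s n h)%E.
  by apply: measurableT_comp => //; exact: measurable_int (ints n).
have s_le0 n h : D h -> (0 <= - s n h)%E.
  move=> /D0 h0; rewrite oppe_ge0.
  by have [] := truncated_moment_rhs_bounds _ phi (c h) M n hphi hgr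
    (fun i => cge0 h i h0) (cM h h0).

(* Integrated balance of the truncated moments *)
pose E n := (\int[lebesgue_measure]_(h in D) (- s n h))%E.
have intsE n : (\int[lebesgue_measure]_(h in D) s n h = - E n)%E.
  rewrite /E -integral_ge0N; last exact: s_le0.
  by apply: eq_integral => h _; rewrite oppeK.
have Efin n : E n \is a fin_num.
  by rewrite -fin_numN -intsE; exact: integrable_fin_num.
pose mom n (h : R) := (\sum_(1 <= i < n.+1) (i%:R * c h i)%:E)%E.
(* The integral equations, weighted by i and summed up to n: [E n] is the mass that leaves the first
   n sizes during [0, t]. *)
have momE n : mom n 0%R = (mom n t + E n)%E.
  suff -> : (mom n t = mom n 0%R - E n)%E by rewrite subeK.
  rewrite -intsE integral_sum// /mom -big_split/=.
  apply: eq_big_nat => i /andP[i0 _].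
  rewrite EFinM (sd_integral_equation hc i0 (inT t t0)) -/D EFinM.
  rewrite muleDr//.
  by rewrite integralZl//; exact: irhs.

(* Time integrals of the weighted concentrations *)
pose a j := (\int[lebesgue_measure]_(h in D) (j%:R * c h j)%:E)%E.
have a0 j : (0 <= a j)%E by apply: integral_ge0 => h /D0; exact: w0.
have M0 : 0 <= M.
  by rewrite -lee_fin (le_trans _ (cM 0 _))// nneseries_ge0// => j _ _; exact: w0.
have tailE k : (\int[lebesgue_measure]_(h in D)
    \sum_(k <= j <oo) (j%:R * c h j)%:E = \sum_(k <= j <oo) a j)%E.
  rewrite -nneseries_addn//.
  (* Termwise integration of a nonnegative series, after a shift of the index by k. *)
  have /= <- := integral_nneseries (@lebesgue_measure R) mD
    (fun j => mw (j + k)%N) (fun j h Dh => w0 h (j + k)%N (D0 h Dh)).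
  apply: eq_integral => h; rewrite inE => /D0 h0.
  by rewrite -(@nneseries_addn _ (fun j => (j%:R * c h j)%:E))// => j; exact: w0.
have mtail k : measurable_fun D (fun h => \sum_(k <= j <oo) (j%:R * c h j)%:E)%E.
  under eq_fun do rewrite eseries_cond.
  by apply: (@ge0_emeasurable_sum _ _ _ _ _ (leq k)) => // j h /D0 h0 _; exact: w0.
have aM : (\sum_(0 <= j <oo) a j <= (M * t)%:E)%E.
  rewrite -tailE; apply: (@le_trans _ _ (\int[lebesgue_measure]_(h in D) M%:E)%E).
    apply: ge0_le_integral => //.
    - by move=> h /D0 h0; apply: nneseries_ge0 => j _ _; exact: w0.
    - exact: mtail.
    - by move=> h /D0; exact: cM.
  rewrite integral_cst//= lebesgue_measure_itv/= lte_fin.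
  by case: ltgtP t0 => // [_|<-] _; rewrite ?oppr0 ?adde0 ?mule0 ?mulr0// oppr0 adde0.
have afin j : a j \is a fin_num.
  rewrite ge0_fin_numE// (@le_lt_trans _ _ (M * t)%:E) ?ltry// (le_trans _ aM)//.
  apply: le_trans (nneseries_lim_ge j.+1 _) => //.
  by rewrite big_nat_recr//= leeDr// sume_ge0.
have EM n : (E n <= (4 * M)%:E * (n.+1%:R%:E * a n + \sum_(n.+1 <= j <oo) a j))%E.
  have mna : measurable_fun D (fun h => n.+1%:R%:E * (n%:R * c h n)%:E)%E.
    by apply: emeasurable_funM; [exact: measurable_cst|exact: mw].
  have na0 h : D h -> (0 <= n.+1%:R%:E * (n%:R * c h n)%:E)%E.
    by move=> /D0 h0; rewrite mule_ge0// ?w0// lee_fin.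
  have tail0 h : D h -> (0 <= \sum_(n.+1 <= j <oo) (j%:R * c h j)%:E)%E.
    by move=> /D0 h0; apply: nneseries_ge0 => j _ _; exact: w0.
  have mnat := emeasurable_funD mna (mtail n.+1).
  have naE : (\int[lebesgue_measure]_(h in D) (n.+1%:R%:E * (n%:R * c h n)%:E) =
      n.+1%:R%:E * a n)%E.
    by apply: ge0_integralZl_EFin => //; [move=> h /D0; exact: w0|exact: mw].
  rewrite -tailE -naE -ge0_integralD//; last exact: mtail.
  rewrite -ge0_integralZl_EFin//; last 2 first.
  - by move=> h Dh; rewrite adde_ge0 ?na0 ?tail0.
  - by rewrite mulr_ge0.
  apply: ge0_le_integral => //.
  - exact: s_le0.
  - exact: ms.
  - by apply: emeasurable_funM => //; exact: measurable_cst.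
  move=> h /D0 h0.
  by have [] := truncated_moment_rhs_bounds _ phi (c h) M n hphi hgr
    (fun i => cge0 h i h0) (cM h h0).
have mom_le n (h : R) : 0 <= h -> (mom n h <= density (c h))%E.
  by move=> h0; apply: nneseries_lim_ge => j _ _; exact: w0.
have density_le (h : R) y : 0 <= h -> (forall n, mom n h <= y)%E -> (density (c h) <= y)%E.
  move=> h0 momy; apply: lime_le; first by apply: is_cvg_nneseries => j _ _; exact: w0.
  (* Partial sums stop before their upper index, so [mom n] is the one of index n+1; index 0 gives
     the empty sum, equal to [mom 0]. *)
  apply: nearW => -[|n]; last exact: momy.
  by have := momy 0%N; rewrite /mom !big_geq.

(* The two inequalities between the densities *)
apply/eqP; rewrite eq_le; apply/andP; split.
  apply: density_le => // n; apply: le_trans (mom_le n 0 _) => //.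
  by rewrite momE leeDl//; apply: integral_ge0; exact: s_le0.
apply/lee_addgt0Pr => e e0; apply: density_le => // k.
(* Two errors of size d, multiplied by 4M, give 8Md <= e; the added 1 keeps the denominator positive
   when M = 0. *)
pose d := e / (8 * M + 1).
have d0 : 0 < d by rewrite divr_gt0//; lra.
have [N _ tailN] : \forall N \near \oo, (\sum_(N <= j <oo) a j <= d%:E)%E.
  have /fine_cvgP[tfin tcvg] : (\sum_(N <= j <oo) a j @[N --> \oo] --> 0%:E)%E.
    by apply: nneseries_tail_cvg => //; rewrite (le_lt_trans aM)// ltry.
  apply: filterS2 tfin (cvgr_le 0 tcvg d d0) => m mfin.
  by rewrite -lee_fin/= fineK.
(* n >= N controls the tail, while n >= k gives [mom k 0 <= mom n 0], so the good index n may depend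
   on k. *)
have [n nN nd] : exists2 n, (maxn N k <= n)%N & n.+1%:R * fine (a n) <= d.
  apply: (@summable_frequently_le_harmonic _ _ (M * t)) => // n.
    by rewrite fine_ge0.
  rewrite -lee_fin -sumEFin (le_trans _ aM)//.
  under eq_bigr do rewrite fineK//.
  exact: nneseries_lim_ge.
move: nN; rewrite geq_max => /andP[Nn kn].
have En : (E n <= e%:E)%E.
  apply: (le_trans (EM n)); apply: (@le_trans _ _ ((4 * M)%:E * (d%:E + d%:E))%E).
    rewrite lee_wpmul2l ?lee_fin ?mulr_ge0// leeD//.
      by rewrite -(fineK (afin n)) -EFinM lee_fin.
    by apply: tailN => /=; exact: leqW.
  rewrite -EFinD -EFinM lee_fin.
  have -> : e = (8 * M + 1) * d by rewrite /d mulrC divfK//; lra.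
  lra.
apply: (@le_trans _ _ (mom n 0%R)).
  rewrite /mom (@big_cat_nat _ _ _ k.+1 1 n.+1)//= leeDl// big_nat_cond.
  by apply: sume_ge0 => j _; exact: w0.
by rewrite momE leeD// mom_le.
Qed.
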